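(* Let $L_0\subseteq L$ be first-order languages, let $M$ be an $L$-structure with reduct $M_0:=M\upharpoonright L_0$, and assume $M$ has the right expansion property for $L_0$. Let $\mathcal{M}_0$, $\mathcal{M}_0^*$, $\operatorname{Aut}(M)^*$ and $\Sigma^{\mathcal{M}_0}$ be as in the context, let $\sigma\in\operatorname{Aut}(M)^*$ and $p:=\operatorname{tp}^{\mathrm{full}}(\sigma(\bar m))\in\Sigma^{\mathcal{M}_0}$, and assume $p\cdot g=p$ for all $g\in\operatorname{Aut}(M)$. Then $\operatorname{cl}(p\cdot\operatorname{Aut}(M_0))$ is the universal minimal right $\operatorname{Aut}(M_0)$-flow.
   Context: Groups of automorphisms carry the pointwise convergence topology; $\operatorname{Aut}(M)\leq\operatorname{Aut}(M_0)$. $M$ has the right expansion property for $L_0$ if for every finite $A\subseteq M$ there is a finite $B\subseteq M$ such that for every $\sigma\in\operatorname{Aut}(M_0)$ there is $\tau\in\operatorname{Aut}(M)$ with $\tau[A]\subseteq\sigma[B]$. $\bar m$ is an enumeration of $M$. $\mathcal{M}_0$ is the two-sorted structure with sorts $\operatorname{Aut}(M_0)$ and $M$ and a predicate for every subset of every finite Cartesian product of sorts (the full language); $\mathcal{M}_0^*=(\operatorname{Aut}(M_0)^*,M^*,\dots)$ is a monster model of its theory, and $\operatorname{Aut}(M)^*\subseteq\operatorname{Aut}(M_0)^*$ is the interpretation of the predicate for the subset $\operatorname{Aut}(M)$. $\operatorname{tp}^{\mathrm{full}}$ is the complete type over $\emptyset$ in the full language of $\mathcal{M}_0$, and $\Sigma^{\mathcal{M}_0}:=\{\operatorname{tp}^{\mathrm{full}}(\rho(\bar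 m)):\rho\in\operatorname{Aut}(M_0)^*\}$ with the topology induced from the type space (basic clopens $[\varphi]=\{q:\varphi\in q\}$) and the right action $\operatorname{tp}^{\mathrm{full}}(\rho(\bar m))\cdot g:=\operatorname{tp}^{\mathrm{full}}(\rho(g(\bar m)))$ for $g\in\operatorname{Aut}(M_0)$. A right flow is a compact Hausdorff space with a continuous right action; it is minimal if it has no proper nonempty closed invariant subset; a universal minimal right flow is a minimal right flow admitting a continuous equivariant surjection onto every minimal right flow. *)

(* Defs.v *)
From HB Require Import structures.
From mathcomp Require Import all_boot.
From mathcomp Require Import all_classical topology.

Set Implicit Arguments.
Unset Strict Implicit.
Unset Printing Implicit Defensive.

Local Open Scope classical_set_scope.
Local Open Scope card_scope.

Set Warnings "-redundant-canonical-projection".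

HB.structure Definition PreTopologicalGroup :=
  {G of Topological G & Group G}.

Record language := Language {
  fsym : Type;
  farity : fsym -> nat;
  rsym : Type;
  rarity : rsym -> nat }.

Record sublanguage (L : language) := Sublanguage {
  sub_fsym : set (fsym L);
  sub_rsym : set (rsym L) }.

Definition language_of_sub (L : language) (L0 : sublanguage L) : language :=
  {| fsym := set_type (sub_fsym L0);
     farity := fun f => farity (set_val f);
     rsym := set_type (sub_rsym L0);
     rarity := fun r => rarity (set_val r) |}.

Coercion language_of_sub : sublanguage >-> language.

Record structure (L : language) := Structure {
  univ :> Type;
  finterp : forall f : fsym L, ('I_(farity f) -> univ) -> univ;
  rinterp : forall r : rsym L, ('I_(rarity r) -> univ) -> Prop }.

Definition reduct (L : language) (L0 : sublanguage L) (M : structure L) :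
    structure L0 :=
  @Structure L0 M (fun f => @finterp L M (set_val f))
                  (fun r => @rinterp L M (set_val r)).

Definition is_automorphism (L : language) (M : structure L) (g : M -> M) :=
  [/\ bijective g,
      forall (f : fsym L) (x : 'I_(farity f) -> M),
        g (finterp x) = finterp (g \o x) &
      forall (r : rsym L) (x : 'I_(rarity r) -> M),
        rinterp x <-> rinterp (g \o x)].

Record aut (L : language) (M : structure L) := Aut {
  aut_fun :> M -> M;
  aut_is_automorphism : is_automorphism aut_fun }.

Section AutGroup.
Variables (L : language) (M : structure L).
Implicit Types g h k : aut M.

Lemma aut_eq g h : (forall x, g x = h x) -> g = h.
Proof.
case: g => g gP; case: h => h hP /= /funext gh.
by subst h; rewrite (Prop_irrelevance gP hP).
Qed.

Fact aut_one_subproof : is_automorphism (fun x : M => x).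
Proof. by split => //; exists id. Qed.

Definition aut_one : aut M := Aut aut_one_subproof.

Fact aut_mul_subproof g h : is_automorphism (fun x => g (h x)).
Proof.
case: g h => g [bg fg rg] [h [bh fh rh]] /=; split.
- exact: bij_comp.
- by move=> f x; rewrite fh fg.
- by move=> r x; rewrite rh rg.
Qed.

Definition aut_mul g h : aut M := Aut (aut_mul_subproof g h).

Fact aut_inv_subproof g : {h : M -> M | cancel g h /\ cancel h g}.
Proof. by apply: cid; case: g => g [[h gK hK] _ _] /=; exists h. Qed.

Fact aut_inv_is_automorphism g : is_automorphism (sval (aut_inv_subproof g)).
Proof.
case: aut_inv_subproof => /= h [gK hK]; case: g gK hK => g [bg fg rg] /= gK hK.
have gh n (x : 'I_n -> M) : g \o (h \o x) = x by apply/funext => i /=.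
split; first by exists g.
- by move=> f x; rewrite -{1}(gh _ x) -fg gK.
- by move=> r x; rewrite [X in _ <-> X]rg gh.
Qed.

Definition aut_inv g : aut M := Aut (aut_inv_is_automorphism g).

HB.instance Definition _ := gen_eqMixin (aut M).
HB.instance Definition _ := gen_choiceMixin (aut M).

Fact aut_mulA : associative aut_mul.
Proof. by move=> g h k; exact: aut_eq. Qed.

Fact aut_mul1 : left_id aut_one aut_mul.
Proof. by move=> g; exact: aut_eq. Qed.

Fact aut_1mul : right_id aut_one aut_mul.
Proof. by move=> g; exact: aut_eq. Qed.

Fact aut_mulV : left_inverse aut_one aut_inv aut_mul.
Proof.
by move=> g; apply: aut_eq => x /=; case: aut_inv_subproof => h [gK hK] /=.
Qed.

Fact aut_Vmul : right_inverse aut_one aut_inv aut_mul.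
Proof.
by move=> g; apply: aut_eq => x /=; case: aut_inv_subproof => h [gK hK] /=.
Qed.

HB.instance Definition _ :=
  isGroup.Build (aut M) aut_mulA aut_mul1 aut_1mul aut_mulV aut_Vmul.

(* The topology of pointwise convergence, M being discrete. *)
Definition aut_subbase : set (set (aut M)) :=
  [set U | exists a b : M, U = [set g : aut M | g a = b]].

HB.instance Definition _ :=
  isSubBaseTopological.Build (aut M) aut_subbase id.

End AutGroup.

(* Aut(M) as a subgroup of Aut(M|L0). *)
Definition expansion_aut (L : language) (L0 : sublanguage L) (M : structure L) :
    set (aut (reduct L0 M)) :=
  [set g | is_automorphism (M := M) g].

Arguments expansion_aut {L} L0 M _.

Definition right_expansion_property (L : language) (L0 : sublanguage L)
    (M : structure L) :=
  forall A : set M, finite_set A ->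
  exists2 B : set M, finite_set B &
    forall sigma : aut (reduct L0 M),
    exists tau : aut M, tau @` A `<=` sigma @` B.

Section Flows.
Variable G : PreTopologicalGroup.type.

Definition right_flow (X : topologicalType) (act : X -> G -> X) :=
  [/\ compact [set: X], hausdorff_space X,
      forall x, act x 1%g = x,
      forall x g h, act x (g * h)%g = act (act x g) h &
      continuous (fun xg : X * G => act xg.1 xg.2)].

(* Flows are understood to be nonempty; this is recorded in minimality, as
   otherwise the empty flow would be minimal. *)
Definition minimal_right_flow (X : topologicalType) (act : X -> G -> X) :=
  [/\ right_flow act, [set: X] !=set0 &
      forall F : set X, closed F -> F !=set0 ->
        (forall x g, F x -> F (act x g)) -> F = [set: X]].

Definition universal_minimal_right_flow
    (X : topologicalType) (act : X -> G -> X) :=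
  minimal_right_flow act /\
  forall (Y : topologicalType) (actY : Y -> G -> Y), minimal_right_flow actY ->
  exists f : X -> Y,
    [/\ continuous f, forall x g, f (act x g) = actY (f x) g
      & range f = [set: Y]].

End Flows.

Fixpoint hprod (S : Type) (X : S -> Type) (w : seq S) : Type :=
  if w is s :: w' then (X s * hprod X w')%type else unit.

Fixpoint hmap (S : Type) (X Y : S -> Type) (f : forall s, X s -> Y s)
    (w : seq S) : hprod X w -> hprod Y w :=
  if w is s :: w' then fun v => (f s v.1, hmap f v.2) else fun=> tt.

Record signature := Signature {
  sort : Type;
  rel_sym : Type;
  arity : rel_sym -> seq sort }.

Record sstructure (S : signature) := SStructure {
  carrier :> sort S -> Type;
  interp : forall r : rel_sym S, set (hprod carrier (arity r)) }.

(* The sorted variable context V extended by one variable of sort s. *)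
Definition snoc (S : Type) (V : S -> Type) (s : S) : S -> Type :=
  fun t => (V t + (s = t))%type.

(* Formulas whose free variables of sort s range over V s. *)
Inductive formula (S : signature) (V : sort S -> Type) : Type :=
| Falsum
| Equal s of V s & V s
| Atom r of hprod V (arity r)
| Implies of formula V & formula V
| Forall s of formula (snoc V s).

Arguments Falsum {S V}.

Definition Exists (S : signature) (V : sort S -> Type) (s : sort S)
    (phi : formula (snoc V s)) : formula V :=
  Implies (Forall (Implies phi Falsum)) Falsum.

Definition env_snoc (S : Type) (V X : S -> Type) (s : S)
    (e : forall t, V t -> X t) (a : X s) : forall t, snoc V s t -> X t :=
  fun t v => match v with
             | inl x => e t x
             | inr st => match st in _ = t return X t with erefl => a end
             end.

Fixpoint sat (S : signature) (N : sstructure S) (V : sort S -> Type)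
    (phi : formula V) : (forall s, V s -> N s) -> Prop :=
  match phi with
  | Falsum => fun=> False
  | Equal s x y => fun e => e s x = e s y
  | Atom r v => fun e => interp (hmap e v)
  | Implies phi psi => fun e => sat phi e -> sat psi e
  | Forall s phi => fun e => forall a : N s, sat phi (env_snoc e a)
  end.

Definition elementary (S : signature) (N N' : sstructure S)
    (j : forall s, N s -> N' s) :=
  forall (V : sort S -> Type) (phi : formula V) (e : forall s, V s -> N s),
    sat phi e <-> sat phi (fun s x => j s (e s x)).

Record elem_emb (S : signature) (N N' : sstructure S) := ElemEmb {
  emb_fun :> forall s, N s -> N' s;
  emb_elementary : elementary emb_fun }.

Section Monster.
Variables (S : signature) (K : Type) (N : sstructure S).

(* K stands for the cardinal kappa = |K|. *)
Definition card_lt_K (T : Type) (A : set T) := ~~ ([set: K] #<= A).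

Definition params (A : set {s & N s}) : sort S -> Type :=
  fun s => {a : N s | A (existT _ s a)}.

Definition params_val (A : set {s & N s}) s (a : params A s) : N s := sval a.

Definition saturated :=
  forall A : set {s & N s}, card_lt_K A ->
  forall (s : sort S) (pi : set (formula (snoc (params A) s))),
    (forall F, finite_set F -> F `<=` pi ->
       exists b : N s, forall phi, F phi ->
         sat phi (env_snoc (@params_val A) b)) ->
    exists b : N s, forall phi, pi phi -> sat phi (env_snoc (@params_val A) b).

Definition is_sautomorphism (alpha : forall s, N s -> N s) :=
  (forall s, bijective (alpha s)) /\
  forall (r : rel_sym S) (v : hprod N (arity r)),
    interp v <-> interp (hmap alpha v).

Definition strongly_homogeneous :=
  forall A : set {s & N s}, card_lt_K A ->
  forall f : forall s, params A s -> N s,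
    (forall phi : formula (params A),
       sat phi (@params_val A) <-> sat phi f) ->
    exists2 alpha, is_sautomorphism alpha &
      forall s (a : params A s), alpha s (params_val a) = f s a.

(* kappa-saturated and strongly kappa-homogeneous, where kappa exceeds the
   number of sentences of the language. *)
Definition monster :=
  [/\ card_lt_K [set: formula (fun _ : sort S => void)],
      saturated & strongly_homogeneous].

End Monster.

Record full_rel (S : Type) (X : S -> Type) := FullRel {
  full_arity : seq S;
  full_set : set (hprod X full_arity) }.

Definition full_signature (S : Type) (X : S -> Type) : signature :=
  {| sort := S; rel_sym := full_rel X; arity := @full_arity S X |}.

Definition full_structure (S : Type) (X : S -> Type) :
    sstructure (full_signature X) :=
  @SStructure (full_signature X) X (@full_set S X).

Inductive two_sorts := AutSort | HomeSort.

Definition two_sorted (G T : Type) : two_sorts -> Type :=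
  fun s => match s with AutSort => G | HomeSort => T end.

Notation calM_sig M0 := (full_signature (two_sorted (aut M0) M0)).

Definition calM (L : language) (M0 : structure L) : sstructure (calM_sig M0) :=
  full_structure (two_sorted (aut M0) M0).

Section Sigma.
Variables (L : language) (M0 : structure L).
Local Notation base := (two_sorted (aut M0) M0).
Local Notation sig := (calM_sig M0).
Variables (N : sstructure sig) (iota : elem_emb (calM M0) N).
Variables (I : Type) (m : I -> M0).

Definition aut_star (D : set (aut M0)) : set (N AutSort) :=
  [set rho | @interp sig N (@FullRel _ base [:: AutSort] [set v | D v.1])
               (rho, tt)].

Definition app_sym : rel_sym sig :=
  @FullRel _ base [:: AutSort; HomeSort; HomeSort]
    [set v | (v.1 : aut M0) v.2.1 = v.2.2.1].

Definition app_rel (rho : N AutSort) (a b : N HomeSort) : Prop :=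
  @interp sig N app_sym (rho, (a, (b, tt))).

(* The default value is never used: see app_starP and app_star_unique. *)
Definition app_star (rho : N AutSort) (a : N HomeSort) : N HomeSort :=
  if pselect (exists b, app_rel rho a b) is left ex then sval (cid ex) else a.

Definition home_env (b : I -> N HomeSort) :
    forall s, two_sorted void I s -> N s :=
  fun s => match s with
           | AutSort => fun v : void => match v with end
           | HomeSort => b
           end.

Definition tp (b : I -> N HomeSort) :
    set (@formula sig (two_sorted void I)) :=
  [set phi : @formula sig (two_sorted void I) | sat phi (home_env b)].

(* For x a tuple of elements of M, the tuple rho(x). *)
Definition star_tuple (rho : N AutSort) (x : I -> M0) : I -> N HomeSort :=
  fun i => app_star rho (iota HomeSort (x i)).

Record Sigma := MkSigma {
  Sigma_tp :> set (@formula sig (two_sorted void I));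
  Sigma_tpP : exists rho, Sigma_tp = tp (star_tuple rho m) }.

Definition Sigma_of (rho : N AutSort) : Sigma :=
  MkSigma (ex_intro _ rho erefl).

Lemma Sigma_eq (p q : Sigma) : Sigma_tp p = Sigma_tp q -> p = q.
Proof.
case: p q => [p pP] [q qP] /= E; subst q.
by rewrite (Prop_irrelevance pP qP).
Qed.

HB.instance Definition _ := gen_eqMixin Sigma.
HB.instance Definition _ := gen_choiceMixin Sigma.

Definition Sigma_base : set (set Sigma) :=
  [set U | exists phi, U = [set q : Sigma | Sigma_tp q phi]].

Fact Sigma_base_cover : \bigcup_(U in Sigma_base) U = setT.
Proof.
apply/seteqP; split => // q _.
exists [set q : Sigma | Sigma_tp q (Implies Falsum Falsum)].
  by exists (Implies Falsum Falsum).
by have [rho /= ->] := Sigma_tpP q.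
Qed.

Fact Sigma_base_join (U V : set Sigma) (q : Sigma) :
  Sigma_base U -> Sigma_base V -> U q -> V q ->
  exists W, [/\ Sigma_base W, W q & W `<=` U `&` V].
Proof.
move=> [phi ->] [psi ->] /= qphi qpsi.
exists [set q : Sigma |
  Sigma_tp q (Implies (Implies phi (Implies psi Falsum)) Falsum)].
split; first by eexists.
  by move: qphi qpsi; have [rho /= ->] := Sigma_tpP q => ? ?; apply.
move=> r /=; have [rho ->] := Sigma_tpP r; rewrite /tp /= => H.
by split; apply: contrapT => nH; apply: H => h h'; apply: nH.
Qed.

HB.instance Definition _ :=
  isBaseTopological.Build Sigma Sigma_base_cover Sigma_base_join.

Lemma transfer (V : two_sorts -> Type) (phi : @formula sig V)
    (e : forall s, V s -> base s) :
  sat (N := calM M0) phi e -> sat phi (fun s x => iota s (e s x)).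
Proof. by move/(emb_elementary iota). Qed.

Let no_env : forall s : two_sorts, void -> base s := fun s v => match v with end.

Lemma app_starP rho a : app_rel rho a (app_star rho a).
Proof.
suff ex : exists b, app_rel rho a b.
  by rewrite /app_star; case: pselect => // H; exact: svalP (cid H).
pose phi : @formula sig (fun=> void) :=
  Forall (S := sig) (s := AutSort) (Forall (S := sig) (s := HomeSort)
    (Exists (S := sig) (s := HomeSort) (Atom (S := sig) (r := app_sym)
      (inl (inl (inr erefl)), (inl (inr erefl), (inr erefl, tt)))))).
have /transfer H : sat (N := calM M0) phi no_env.
  by move=> r x /(_ ((r : aut M0) x)); apply.
by apply: contrapT => nE; apply: (H rho a) => b ab; apply: nE; exists b.
Qed.

Lemma app_star_unique rho a b : app_rel rho a b -> b = app_star rho a.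
Proof.
pose phi : @formula sig (fun=> void) :=
  Forall (S := sig) (s := AutSort) (Forall (S := sig) (s := HomeSort)
  (Forall (S := sig) (s := HomeSort) (Forall (S := sig) (s := HomeSort)
    (Implies
      (Atom (S := sig) (r := app_sym) (inl (inl (inl (inr erefl))),
        (inl (inl (inr erefl)), (inl (inr erefl), tt))))
      (Implies
        (Atom (S := sig) (r := app_sym) (inl (inl (inl (inr erefl))),
          (inl (inl (inr erefl)), (inr erefl, tt))))
        (Equal (S := sig) (s := HomeSort) (inl (inr erefl)) (inr erefl))))))).
have /transfer H : sat (N := calM M0) phi no_env.
  by move=> r x y z /= -> ->.
by move=> ab; apply: (H rho a b (app_star rho a)) => //; exact: app_starP.
Qed.

Fact Sigma_act_subproof (rho : N AutSort) (g : aut M0) :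
  exists rho', tp (star_tuple rho (g \o m)) = tp (star_tuple rho' m).
Proof.
pose mul_sym : rel_sym sig := @FullRel _ base [:: AutSort; AutSort]
  [set v | v.2.1 = aut_mul v.1 g].
pose g_sym : rel_sym sig := @FullRel _ base [:: HomeSort; HomeSort]
  [set v | v.2.1 = g v.1].
pose phi : @formula sig (fun=> void) :=
  Forall (S := sig) (s := AutSort) (Exists (S := sig) (s := AutSort)
  (Forall (S := sig) (s := HomeSort) (Forall (S := sig) (s := HomeSort)
  (Forall (S := sig) (s := HomeSort)
    (Implies (Atom (S := sig) (r := g_sym)
               (inl (inl (inr erefl)), (inl (inr erefl), tt)))
    (Implies (Atom (S := sig) (r := app_sym)
               (inl (inl (inl (inl (inr erefl)))),
                (inl (inr erefl), (inr erefl, tt))))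
             (Atom (S := sig) (r := app_sym)
               (inl (inl (inl (inr erefl))),
                (inl (inl (inr erefl)), (inr erefl, tt)))))))))).
have /transfer H : sat (N := calM M0) phi no_env.
  by move=> r /(_ (aut_mul r g)); apply => x y z /= -> ->.
apply: contrapT => nE; apply: (H rho) => rho' {}H; apply: nE.
exists rho'; congr tp; apply/funext => i; apply: app_star_unique.
apply: (H (iota HomeSort (m i)) (iota HomeSort (g (m i)))); last exact: app_starP.
pose v : hprod base [:: HomeSort; HomeSort] := (m i, (g (m i), tt)).
pose e (s : two_sorts) (x : base s) : base s := x.
have /transfer : sat (N := calM M0) (Atom (S := sig) (r := g_sym) v) e by [].
by [].
Qed.

(* tp(rho(m)) . g := tp(rho(g(m))), for a chosen rho; independence of the
   choice is Sigma_actE. *)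
Definition Sigma_act (q : Sigma) (g : aut M0) : Sigma :=
  MkSigma (Sigma_act_subproof (sval (cid (Sigma_tpP q))) g).

End Sigma.

Fixpoint rename (S : signature) (V W : sort S -> Type)
    (f : forall s, V s -> W s) (phi : formula V) {struct phi} : formula W :=
  match phi with
  | Falsum => Falsum
  | Equal s x y => Equal (f s x) (f s y)
  | Atom r v => Atom (hmap f v)
  | Implies phi psi => Implies (rename f phi) (rename f psi)
  | Forall s phi => Forall (rename (fun t (v : snoc V s t) =>
      match v return snoc W s t with
      | inl x => inl (f t x)
      | inr st => inr st
      end) phi)
  end.

Lemma hmap_comp (S : Type) (X Y Z : S -> Type) (f : forall s, X s -> Y s)
    (h : forall s, Y s -> Z s) w (v : hprod X w) :
  hmap h (hmap f v) = hmap (fun s x => h s (f s x)) v.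
Proof. by elim: w v => //= s w IH [a v] /=; rewrite IH. Qed.

Lemma sat_rename (S : signature) (N : sstructure S) (V W : sort S -> Type)
    (f : forall s, V s -> W s) (phi : formula V) (e : forall s, W s -> N s) :
  sat (rename f phi) e <-> sat phi (fun s x => e s (f s x)).
Proof.
elim: phi W f e => {V} [V|V s x y|V r v|V p IHp q IHq|V s p IHp] W f e //=.
- by rewrite hmap_comp.
- by rewrite IHp IHq.
- have E a : (fun t (v : snoc V s t) => env_snoc e a
      match v return snoc W s t with inl x => inl (f t x) | inr st => inr st end)
    = env_snoc (fun t x => e t (f t x)) a.
    by apply: functional_extensionality_dep => t; apply/funext => -[].
  by split=> H a; have := H a; rewrite IHp E.
Qed.

Lemma Sigma_actE (L : language) (M0 : structure L)
    (N : sstructure (calM_sig M0))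
    (iota : elem_emb (calM M0) N) (I : Type) (m : I -> M0) :
  range m = setT ->
  forall (rho : N AutSort) (g : aut M0),
  Sigma_tp (Sigma_act (Sigma_of iota m rho) g) =
  tp (star_tuple iota rho (g \o m)).
Proof.
move=> m_surj rho g.
have /choice[j jE] i : exists j, m j = g (m i).
  have : range m (g (m i)) by rewrite m_surj.
  by case=> j _ <-; exists j.
rewrite /Sigma_act /=; case: cid => /= rho' E.
pose f s : two_sorted void I s -> two_sorted void I s :=
  match s with AutSort => id | HomeSort => j end.
have tpE r : tp (star_tuple iota r (g \o m)) =
    [set phi : formula _ | tp (star_tuple iota r m) (rename (S := full_signature _) f phi)].
  apply/seteqP; suff H (phi : formula _) : tp (star_tuple iota r (g \o m)) phi <->
      tp (star_tuple iota r m) (rename (S := full_signature _) f phi) by split=> phi /H.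
  rewrite /tp /= sat_rename.
  suff -> : home_env (star_tuple iota r (g \o m)) =
      fun s x => home_env (star_tuple iota r m) (f s x) by [].
  apply: functional_extensionality_dep => -[]; apply/funext => x //=.
  by rewrite /star_tuple /= jE.
by rewrite !tpE E.
Qed.

(* Main.v *)
(** A formula [phi(rho(m))] involves only finitely many coordinates of [m], and
since [rho(m i)] is definable from [rho] it is a condition on [rho] alone. Hence
saturation makes Sigma compact, and every type in Sigma is a limit of types
[g(m)] with [g] in Aut(M0). For a right flow [Y] and a point [y0], the points
[y0 . g] converge as the type of [g(m)] tends to [q]: by compactness of [Y],
[y0 . g] moves little when [g] is multiplied on the right by an element fixing a
large finite set, so a suitable right-saturated set decides on which side of a
neighbourhood the limit lies. This gives an equivariant map from Sigma to [Y],
onto on every subflow if [Y] is minimal.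

The orbit closure of [p] is minimal because return times are syndetic: if [phi]
holds in [p] and speaks about the coordinates in a finite set [A], the expansion
property gives [B] such that each [g[B]] contains some [tau[A]] with [tau] in
Aut(M); as [p . tau = p], a finite set of translates, one for each copy of [A]
inside [B], suffices. *)

Require Import Defs.
From HB Require Import structures.
From mathcomp Require Import all_boot.
From mathcomp Require Import all_classical topology.

Set Implicit Arguments.
Unset Strict Implicit.
Unset Printing Implicit Defensive.

Local Open Scope classical_set_scope.

(** * Finite supports of formulas *)

Lemma hprod_support (S : Type) (V : S -> Type) (w : seq S) (v : hprod V w) :
  exists l : seq {classic {s & V s}},
    forall (X : S -> Type) (e e' : forall s, V s -> X s),
      (forall s x, (existT V s x : {classic _}) \in l -> e s x = e' s x) ->
      hmap e v = hmap e' v.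
Proof.
elim: w v => [|s w IH] /= v; first by exists [::].
have [l lP] := IH v.2.
exists ((existT V s v.1 : {classic _}) :: l) => X e e' ee'.
congr pair; first by apply: ee'; rewrite mem_head.
by apply: lP => t x xl; apply: ee'; rewrite in_cons xl orbT.
Qed.

(** Only finitely many variables occur in a formula; at a quantifier, [pmap] drops the bound
    variable. The list is independent of the structure, and [{classic _}] supplies the decidable
    equality needed for list membership. *)
Lemma formula_support (S : signature) (V : Defs.sort S -> Type) (phi : formula V) :
  exists l : seq {classic {s & V s}},
    forall (N : sstructure S) (e e' : forall s, V s -> N s),
      (forall s x, (existT V s x : {classic _}) \in l -> e s x = e' s x) ->
      sat phi e <-> sat phi e'.
Proof.
elim: phi => {V} [V|V s x y|V r v|V p [l lP] q [k kP]|V s p [l lP]].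
- by exists [::].
- exists [:: (existT V s x : {classic _}); existT V s y] => N e e' ee' /=.
  by rewrite !ee' // !inE eqxx ?orbT.
- by have [l lP] := hprod_support v; exists l => N e e' /lP /= ->.
- exists (l ++ k) => N e e' ee' /=.
  rewrite (lP N e e') ?(kP N e e') // => s x xl;
    by apply: ee'; rewrite mem_cat xl ?orbT.
- pose f (u : {classic {t & snoc V s t}}) : option {classic {t & V t}} :=
    let: existT t v := u in if v is inl x then Some (existT V t x) else None.
  exists (pmap f l) => N e e' ee' /=.
  have E a : sat p (env_snoc e a) <-> sat p (env_snoc e' a).
    apply: lP => t [x|st] //= xl; apply: ee'.
    rewrite mem_pmap; apply/mapP.
    by exists (existT (snoc V s) t (inl x)).
  by split=> H a; apply/E; exact: H.
Qed.

(** * Conditions on rho(m) as conditions on rho *)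

Section Pullback.
Variables (L : language) (M0 : structure L) (I : Type).
Local Notation sig := (calM_sig M0).

Lemma home_support (phi : @formula sig (two_sorted void I)) :
  exists l : seq {classic I},
    forall (N : sstructure sig) (b b' : I -> N HomeSort),
      (forall i : {classic I}, i \in l -> b i = b' i) ->
      sat phi (home_env b) <-> sat phi (home_env b').
Proof.
have [l lP] := formula_support phi.
pose f (u : {classic {s & two_sorted void I s}}) : option {classic I} :=
  let: existT s v := u in
  match s return two_sorted void I s -> option {classic I} with
  | AutSort => fun=> None
  | HomeSort => fun i => Some i
  end v.
exists (pmap f l) => N b b' bb'; apply: lP => -[] //= i il; apply: bb'.
by rewrite mem_pmap; apply/mapP; exists (existT (two_sorted void I) HomeSort i).
Qed.

(** Two copies of [I] are used: [inl i] stands for the argument [a i], [inr i] for a value still to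
    be replaced by rho(a i). *)
Definition pullback_env (N : sstructure sig) (rho : N AutSort)
    (a b : I -> N HomeSort) : forall s, two_sorted unit (I + I) s -> N s :=
  fun s => match s with
           | AutSort => fun=> rho
           | HomeSort => fun v => match v with inl i => a i | inr i => b i end
           end.

(* [rho(a i)] is not a term, so the variables [i] in [l] are bound one at a
   time by [forall y, rho(a i) = y -> _]. *)
Lemma pullback_seq (phi : @formula sig (two_sorted void I))
    (l : seq {classic I}) :
  exists psi : @formula sig (two_sorted unit (I + I)),
    forall (N : sstructure sig) (iota : elem_emb (calM M0) N)
      (rho : N AutSort) (a b : I -> N HomeSort),
      sat psi (pullback_env rho a b) <->
      sat phi (home_env (fun i =>
        if (i : {classic I}) \in l then app_star rho (a i) else b i)).
Proof.
elim: l => [|i l [psi psiP]].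
  pose f s : two_sorted void I s -> two_sorted unit (I + I) s :=
    match s with AutSort => fun v : void => match v with end
               | HomeSort => inr end.
  exists (rename (S := sig) f phi) => N iota rho a b; rewrite sat_rename.
  suff -> : (fun s x => pullback_env rho a b (f s x)) = home_env b by [].
  by apply: functional_extensionality_dep => -[]; apply/funext => // -[].
pose C := two_sorted unit (I + I).
(* [f] turns the value variable of [i] into the variable about to be quantified and keeps all
   others. *)
pose f s : C s -> snoc C HomeSort s :=
  match s return C s -> snoc C HomeSort s with
  | AutSort => inl
  | HomeSort => fun v : I + I => match v with
     | inl j => inl (inl j)
     | inr j => if (j : {classic I}) == i then inr erefl else inl (inr j)
     end
  end.
exists (@Forall sig C HomeSort (Defs.Implies
  (@Atom sig (snoc C HomeSort) (app_sym M0)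
     (inl tt, (inl (inl i), (inr erefl, tt))))
  (rename (S := sig) f psi))) => N iota rho a b /=.
pose b' c j := if (j : {classic I}) == i then c else b j.
have E c : sat (rename (S := sig) f psi) (env_snoc (pullback_env rho a b) c) <->
    sat phi (home_env (fun j => if (j : {classic I}) \in l
      then app_star rho (a j) else b' c j)).
  rewrite sat_rename -(psiP N iota rho a (b' c)).
  suff -> : (fun s x => env_snoc (pullback_env rho a b) c (f s x)) =
      pullback_env rho a (b' c) by [].
  apply: functional_extensionality_dep => -[]; apply/funext => //= -[j|j] //.
  by rewrite /f /b'; case: ifP.
have {}E : sat (rename (S := sig) f psi)
    (env_snoc (pullback_env rho a b) (app_star rho (a i))) <->
    sat phi (home_env (fun j => if (j : {classic I}) \in i :: l
      then app_star rho (a j) else b j)).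
  rewrite E; suff -> : (fun j => if (j : {classic I}) \in l
      then app_star rho (a j) else b' (app_star rho (a i)) j) =
    (fun j => if (j : {classic I}) \in i :: l
      then app_star rho (a j) else b j) by [].
  by apply/funext => j; rewrite in_cons /b'; case: eqP => [->|]; case: ifP.
(* One direction uses the existence of rho(a i), the other its uniqueness. *)
rewrite -E; split=> [H|H c rc].
  exact/H/(app_starP iota).
by rewrite (app_star_unique iota rc).
Qed.

(** Values outside a support [l] of [phi] do not affect its truth, so the two copies of [I] are
    identified by taking [b := a]. As [psi] precedes the structure, the same formula serves in
    [calM] and in its extension. *)
Lemma pullback (phi : @formula sig (two_sorted void I)) :
  exists psi : @formula sig (snoc (two_sorted void I) AutSort),
    forall (N : sstructure sig) (iota : elem_emb (calM M0) N)
      (rho : N AutSort) (a : I -> N HomeSort),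
      sat psi (env_snoc (home_env a) rho) <->
      sat phi (home_env (fun i => app_star rho (a i))).
Proof.
have [l lP] := home_support phi; have [psi psiP] := pullback_seq phi l.
pose f s : two_sorted unit (I + I) s -> snoc (two_sorted void I) AutSort s :=
  match s with
  | AutSort => fun=> inr erefl
  | HomeSort => fun v : I + I => match v with inl i => inl i | inr i => inl i end
  end.
exists (rename (S := sig) f psi) => N iota rho a; rewrite sat_rename.
have -> : (fun s x => env_snoc (home_env a) rho (f s x)) = pullback_env rho a a.
  by apply: functional_extensionality_dep => -[]; apply/funext => //= -[].
by rewrite (psiP N iota); apply: lP => i ->.
Qed.

End Pullback.

(** * Finite intersections in filters and neighbourhoods of automorphisms *)

Lemma filter_finite_forall (T J : Type) (F : set_system T) (X : set J)
    (B : J -> set T) : Filter F -> finite_set X -> (forall x, X x -> F (B x)) ->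
  F [set t | forall x, X x -> B x t].
Proof.
move=> FF finX; have /(finite_seqP (X : set {classic J}))[s ->] := finX.
elim: s => [|x s IH] FB; first by apply: filterS filterT => t _.
have FBx : F (B x) by apply: FB; rewrite /= mem_head.
have FBs : F [set t | forall x, [set` s] x -> B x t].
  by apply: IH => y ys; apply: FB; rewrite /= in_cons (ys : y \in s) orbT.
apply: filterS (filterI FBx FBs) => t [Bxt Bst] y /=.
by rewrite in_cons => /orP[/eqP ->|/Bst].
Qed.

Section AutTopology.
Variables (L : language) (M0 : structure L).

Lemma nbhs_autP (g : aut M0) (W : set (aut M0)) :
  nbhs g W <-> exists l : seq {classic M0},
    [set h : aut M0 | forall x : {classic M0}, x \in l -> h x = g x] `<=` W.
Proof.
split.
  case=> B [[D' sD' <-] [A D'A Ag] BW]; have [F sF FA] := sD' _ D'A.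
  have {sF FA} [s [ss sA]] : exists s : seq (set (aut M0)),
      (forall U, U \in s -> aut_subbase U) /\
      (forall h, (A : set (aut M0)) h <-> forall U, U \in s -> U h).
    exists (finmap.enum_fset F); split=> [U|h]; first by move/sF; rewrite inE.
    by rewrite -FA.
  (* A subbasic set containing [g] is {h | h a = g a} for some [a]; [f] picks such an [a]. *)
  pose f (U : set (aut M0)) : option {classic M0} :=
    if pselect (exists a, U = [set h : aut M0 | h a = g a]) is left ex
    then Some (sval (cid ex)) else None.
  exists (pmap f s) => h hg; apply: BW; exists A => //; apply/sA => U Us.
  have ex : exists a, U = [set h : aut M0 | h a = g a].
    have [a [b Uab]] := ss _ Us; exists a.
    by have /sA/(_ _ Us) := Ag; rewrite Uab /= => ->.
  have fU : f U = Some (sval (cid ex)).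
    rewrite /f; case: pselect => // ex'; congr (Some (sval (cid _))).
    exact: Prop_irrelevance.
  rewrite (svalP (cid ex)) /=; apply: hg.
  by rewrite mem_pmap -fU map_f.
case=> l lW; apply: filterS lW _; elim: l => [|x l IH].
  exact: filterS filterT.
have gx : nbhs g [set h : aut M0 | h x = g x].
  exists [set h : aut M0 | h x = g x]; split => //.
  exists [set [set h : aut M0 | h x = g x]]; last by rewrite bigcup_set1.
  by move=> _ ->; apply: finI_from1; exists x, (g x).
apply: filterS (filterI gx IH) => h [hx hl] y.
by rewrite in_cons => /orP[/eqP ->|/hl].
Qed.

End AutTopology.

(** * Connectives, the standard structure and its number of elements *)

Definition And (S : signature) (V : Defs.sort S -> Type) (phi psi : formula V) :=
  Defs.Implies (Defs.Implies phi (Defs.Implies psi Falsum)) Falsum.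

Lemma sat_And (S : signature) (N : sstructure S) (V : Defs.sort S -> Type)
    (phi psi : formula V) (e : forall s, V s -> N s) :
  sat (And phi psi) e <-> sat phi e /\ sat psi e.
Proof.
split=> /= [H|[h h'] H]; last exact: H.
by split; apply: contrapT => nH; apply: H => h h'; apply: nH.
Qed.

Lemma sat_Exists (S : signature) (N : sstructure S) (V : Defs.sort S -> Type)
    (s : Defs.sort S) (phi : formula (snoc V s)) (e : forall s, V s -> N s) :
  sat (Exists phi) e <-> exists a, sat phi (env_snoc e a).
Proof.
split=> /= [H|[a h] H]; last exact: H h.
by apply: contrapT => nH; apply: H => a h; apply: nH; exists a.
Qed.

Section FullLanguage.
Variables (L : language) (M0 : structure L).
Local Notation sig := (calM_sig M0).

Fact calM_id_elementary : elementary (fun s (x : calM M0 s) => x).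
Proof. by []. Qed.

(** Makes results about elementary extensions, such as [pullback], available in the standard
    structure itself. *)
Definition calM_id : elem_emb (calM M0) (calM M0) := ElemEmb calM_id_elementary.

Lemma app_star_calM (g : aut M0) (a : M0) :
  app_star (N := calM M0) g a = g a.
Proof. by apply/esym/(app_star_unique calM_id). Qed.

Definition shift (I : Type) (j : I -> I)
    (phi : @formula sig (two_sorted void I)) : @formula sig (two_sorted void I) :=
  rename (S := sig)
    (fun s => match s return two_sorted void I s -> two_sorted void I s with
              | AutSort => id | HomeSort => j end) phi.

Lemma sat_shift (I : Type) (N : sstructure sig) (j : I -> I)
    (phi : @formula sig (two_sorted void I)) (b : I -> N HomeSort) :
  sat (shift j phi) (home_env b) <-> sat phi (home_env (b \o j)).
Proof.
rewrite /shift sat_rename; set e := fun s => _.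
suff -> : e = home_env (b \o j) by [].
by apply: functional_extensionality_dep => -[]; apply/funext.
Qed.

(** The full language has a predicate for each singleton, so there are at least as many sentences as
    elements of [M0]. This allows saturation to be used over the image of [M0]. *)
Lemma card_home_sentences (K : Type) (N : sstructure sig) (f : M0 -> N HomeSort) :
  card_lt_K K [set: @formula sig (fun=> void)] ->
  card_lt_K K [set existT N HomeSort (f x) | x in [set: M0]].
Proof.
apply: contraNN => /card_le_trans; apply.
apply: (card_le_trans (card_image_le _ _)).
(* [dec] recovers the singleton {x} from the sentence [enc x], which proves [enc] injective. *)
pose dec_rel (r : rel_sym sig) : set M0 :=
  match r with
  | FullRel w R => match w return set (hprod (two_sorted (aut M0) M0) w) -> set M0 with
     | [:: HomeSort] => fun R x => R (x, tt)
     | _ => fun=> set0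
     end R
  end.
pose dec (phi : @formula sig (fun=> void)) : set M0 :=
  if phi is Forall s (Atom r _) then dec_rel r else set0.
pose enc x : @formula sig (fun=> void) :=
  @Forall sig (fun=> void) HomeSort
    (@Atom sig (snoc (fun=> void) HomeSort)
       (@FullRel _ (two_sorted (aut M0) M0) [:: HomeSort] [set v | v.1 = x])
       (inr erefl, tt)).
have enc_inj : {in enc @^-1` setT &, injective enc}.
  by move=> x y _ _ /(congr1 dec) /= xy; have : [set z | z = y] x by rewrite -xy.
by have := card_ge_preimage enc_inj; rewrite preimage_setT.
Qed.

End FullLanguage.

(** * Sigma as a compact Hausdorff right flow *)

Section SigmaFlow.
Variables (L : language) (M0 : structure L) (N : sstructure (calM_sig M0)).
Variables (iota : elem_emb (calM M0) N) (I : Type) (m : I -> M0).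
Hypothesis hm : range m = [set: M0].
Local Notation sig := (calM_sig M0).
Local Notation form := (@formula sig (two_sorted void I)).
Local Notation Sig := (Sigma iota m).
Implicit Types (q r : Sig) (phi psi : form) (g h : aut M0).

Lemma Sigma_surj q : exists rho, q = Sigma_of iota m rho.
Proof. by have [rho qE] := Sigma_tpP q; exists rho; exact: Sigma_eq. Qed.

Lemma Sigma_Not q phi : Sigma_tp q (Defs.Implies phi Falsum) <-> ~ Sigma_tp q phi.
Proof. by have [rho ->] := Sigma_surj q. Qed.

Lemma Sigma_And q phi psi :
  Sigma_tp q (And phi psi) <-> Sigma_tp q phi /\ Sigma_tp q psi.
Proof. by have [rho ->] := Sigma_surj q; exact: sat_And. Qed.

Lemma nbhs_SigmaP q (W : set Sig) :
  nbhs q W <-> exists2 phi, Sigma_tp q phi & [set r | Sigma_tp r phi] `<=` W.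
Proof.
split=> [[B [[D' sD' <-] [A D'A Aq] BW]]|[phi qphi phiW]].
  have [phi AE] := sD' _ D'A; exists phi; first by move: Aq; rewrite AE.
  by move=> r rphi; apply: BW; exists A => //; rewrite AE.
exists [set r | Sigma_tp r phi]; split => //.
exists [set [set r | Sigma_tp r phi]]; last by rewrite bigcup_set1.
by move=> _ ->; exists phi.
Qed.

Lemma Sigma_hausdorff : hausdorff_space Sig.
Proof.
move=> q r qr; apply: Sigma_eq; apply/seteqP.
suff H q' r' : cluster (nbhs q') r' -> Sigma_tp q' `<=` Sigma_tp r'.
  split; apply: H => // A B qA rB.
  by have [x [? ?]] := qr _ _ rB qA; exists x.
move=> {q r qr} qr phi qphi; apply: contrapT => rphi.
have [] := qr [set x | Sigma_tp x phi]
  [set x | Sigma_tp x (Defs.Implies phi Falsum)].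
- by apply/nbhs_SigmaP; exists phi.
- by apply/nbhs_SigmaP; exists (Defs.Implies phi Falsum) => //; apply/Sigma_Not.
- by move=> x /= [xphi /Sigma_Not].
Qed.

Lemma Sigma_act_sat rho g phi :
  Sigma_tp (Sigma_act (Sigma_of iota m rho) g) phi <->
  sat phi (home_env (star_tuple iota rho (g \o m))).
Proof. by rewrite (Sigma_actE iota hm). Qed.

Lemma exists_shift g : exists j : I -> I, m \o j = g \o m.
Proof.
suff /choice[j jE] : forall i, exists j, m j = g (m i).
  by exists j; exact/funext.
by move=> i; have [j _ <-] : range m (g (m i)) by [rewrite hm]; exists j.
Qed.

(** Since [m] is onto, g(m) is a reindexing of [m], and acting by [g] becomes a substitution of
    variables. Preimages of basic clopen sets under [g] are thus basic clopen. *)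
Lemma Sigma_act_shift q g (j : I -> I) phi : m \o j = g \o m ->
  Sigma_tp (Sigma_act q g) phi <-> Sigma_tp q (shift j phi).
Proof.
move=> jE; have [rho ->] := Sigma_surj q.
rewrite Sigma_act_sat -jE; apply: iff_sym; exact: sat_shift.
Qed.

Lemma Sigma_act1 q : Sigma_act q 1%g = q.
Proof.
have [rho ->] := Sigma_surj q; apply: Sigma_eq.
by rewrite (Sigma_actE iota hm).
Qed.

Lemma Sigma_actM q g h :
  Sigma_act q (g * h)%g = Sigma_act (Sigma_act q g) h.
Proof.
have [jg jgE] := exists_shift g; have [jh jhE] := exists_shift h.
have jE : m \o (jg \o jh) = (g * h)%g \o m.
  apply/funext => i /=; have /(congr1 (@^~ (jh i))) /= -> := jgE.
  by have /(congr1 (@^~ i)) /= -> := jhE.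
apply: Sigma_eq; apply/seteqP; suff H phi : Sigma_tp (Sigma_act q (g * h)%g) phi <->
    Sigma_tp (Sigma_act (Sigma_act q g) h) phi by split=> phi /H.
rewrite (Sigma_act_shift _ _ jE) (Sigma_act_shift _ _ jhE).
rewrite (Sigma_act_shift _ _ jgE); have [rho ->] := Sigma_surj q.
by rewrite /= /tp /= !sat_shift.
Qed.

Lemma Sigma_act_support phi : exists l : seq {classic I},
  forall q g h, (forall i : {classic I}, i \in l -> g (m i) = h (m i)) ->
    Sigma_tp (Sigma_act q g) phi <-> Sigma_tp (Sigma_act q h) phi.
Proof.
have [l lP] := home_support phi; exists l => q g h gh.
have [rho ->] := Sigma_surj q; rewrite !Sigma_act_sat; apply: lP => i il.
by rewrite /star_tuple /= gh.
Qed.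

Lemma Sigma_act_continuous : continuous (fun x : Sig * aut M0 => Sigma_act x.1 x.2).
Proof.
move=> [q g] W /= /nbhs_SigmaP[phi qphi phiW].
have [l lP] := Sigma_act_support phi; have [j jE] := exists_shift g.
pose k : seq {classic M0} := map m l.
(* The first factor handles [g] itself; on the second, [h] agrees with [g] on all coordinates that
   occur in [phi]. *)
exists ([set r | Sigma_tp r (shift j phi)],
  [set h : aut M0 | forall x : {classic M0}, x \in k -> h x = g x]).
  split => /=; last by apply/nbhs_autP; exists k.
  apply/nbhs_SigmaP; exists (shift j phi) => //.
  exact/(Sigma_act_shift _ _ jE).
move=> [r h] /= [rphi hg]; apply: phiW => /=.
apply/(lP r h g); last exact/(Sigma_act_shift _ _ jE).
by move=> i il; apply: hg; exact: (map_f (m : {classic I} -> {classic M0}) il).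
Qed.

(** The formulas whose clopen sets lie in an ultrafilter become, through [T], a partial type in one
    automorphism variable over the image of [M0]. It is finitely satisfiable because the filter is
    proper; saturation realizes it by some [rho], whose type is the limit. *)
Lemma Sigma_compact (K : Type) : monster K N -> compact [set: Sig].
Proof.
case=> cardK sat_N _; rewrite compact_ultra => F FU _.
have /choice[T TP] := @pullback L M0 I.
pose A := [set existT N HomeSort (iota HomeSort x) | x in [set: M0]].
have Aiota i : A (existT N HomeSort (iota HomeSort (m i))) by exists (m i).
pose f s : snoc (two_sorted void I) AutSort s -> snoc (params A) AutSort s :=
  match s with
  | AutSort => fun v => match v with inl v => match v with end | inr e => inr e end
  | HomeSort => fun v => match v with
     | inl i => inl (exist _ (iota HomeSort (m i)) (Aiota i)) | inr e => inr e end
  end.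
have fP phi rho : sat (rename (S := sig) f (T phi))
    (env_snoc (@params_val sig N A) rho) <-> Sigma_tp (Sigma_of iota m rho) phi.
  rewrite /= /tp /= -(TP phi N iota) sat_rename; set e := fun s => _.
  suff -> : e = env_snoc (home_env (fun i => iota HomeSort (m i))) rho by [].
  by apply: functional_extensionality_dep => -[]; apply/funext => -[].
pose pi := [set rename (S := sig) f (T phi) | phi in
  [set phi | F [set q | Sigma_tp q phi]]].
have [X finX Xpi|rho rhoP] :=
    sat_N A (card_home_sentences (iota HomeSort) cardK) AutSort pi.
  (* Several formulas may have the same translation [x]; [B x] collects the types that contain one
     of them. *)
  pose B x := [set q : Sig | exists2 phi, Sigma_tp q phi &
    rename (S := sig) f (T phi) = x].
  have FX : F [set q | forall x, X x -> B x q].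
    apply: filter_finite_forall finX _ => x /Xpi[phi Fphi <-].
    by apply: filterS Fphi => q qphi; exists phi.
  have [q qX] := filter_ex FX; have [rho qE] := Sigma_surj q.
  by exists rho => x /qX[phi qphi <-]; apply/fP; rewrite -qE.
exists (Sigma_of iota m rho); split => // W /nbhs_SigmaP[phi qphi phiW].
apply: filterS phiW _.
(* If the complement were in [F], the negation of [phi] would belong to [pi] and hold at [rho]. *)
have [//|Fn] := in_ultra_setVsetC [set q | Sigma_tp q phi] FU.
have /rhoP/fP/Sigma_Not // : pi (rename (S := sig) f (T (Defs.Implies phi Falsum))).
exists (Defs.Implies phi Falsum) => //=.
by apply: filterS Fn => q /= nq; apply/Sigma_Not.
Qed.

(** * Sets of automorphisms defined by formulas *)

Definition calM_tuples phi : set (aut M0) :=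
  [set g : aut M0 | @sat sig (calM M0) _ phi (home_env (N := calM M0) (g \o m))].

Lemma calM_tuples_And phi psi :
  calM_tuples (And phi psi) = calM_tuples phi `&` calM_tuples psi.
Proof.
have H (g : aut M0) := sat_And phi psi (home_env (N := calM M0) (g \o m)).
by apply/seteqP; split=> g gphi; exact/H.
Qed.

(** Pulled back to rho and quantified existentially, [phi] becomes a statement about [m], which
    descends by elementarity. This is the density of the types of g(m) in Sigma. *)
Lemma calM_tuples_nonempty q phi : Sigma_tp q phi -> calM_tuples phi !=set0.
Proof.
have [rho ->] := Sigma_surj q; have [psi psiP] := pullback phi.
rewrite /= /tp /= -(psiP N iota) => H.
have : sat (Exists psi) (home_env (fun i => iota HomeSort (m i))).
  by apply/sat_Exists; exists rho.
have -> : home_env (fun i => iota HomeSort (m i)) =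
    fun s x => iota s (home_env (N := calM M0) m x).
  by apply: functional_extensionality_dep => -[]; apply/funext => // -[].
move=> /(emb_elementary iota) /sat_Exists[g /(psiP _ (calM_id M0)) gphi].
exists g; rewrite /calM_tuples /=.
suff <- : (fun i => app_star (N := calM M0) g (m i)) = (g : aut M0) \o m by [].
by apply/funext => i; rewrite app_star_calM.
Qed.

Lemma calM_tuples_shift g (j : I -> I) phi : m \o j = g \o m ->
  calM_tuples (shift j phi) = [set h | calM_tuples phi (h * g)%g].
Proof.
move=> jE; rewrite /calM_tuples; apply/seteqP.
suff H h : sat (shift j phi) (home_env (N := calM M0) (h \o m)) <->
    sat phi (home_env (N := calM M0) ((h * g)%g \o m)) by split=> h /H.
rewrite sat_shift; suff -> : (h \o m) \o j = (h * g)%g \o m by [].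
by rewrite -compA jE.
Qed.

(** The right-hand side is [D] times the pointwise stabilizer of [l]. It depends only on the values
    at [l], so it is given by a predicate of the full language, whatever [D] is. *)
Lemma calM_tuples_saturation (D : set (aut M0)) (l : seq {classic M0}) :
  exists phi, calM_tuples phi = [set h : aut M0 |
    exists2 g : aut M0, D g & forall x : {classic M0}, x \in l -> h x = g x].
Proof.
have [k ->] : exists k : seq {classic I}, l = map m k.
  elim: l => [|x l [k ->]]; first by exists [::].
  by have [i _ <-] : range m x by [rewrite hm]; exists (i :: k).
pose w (k : seq {classic I}) : seq two_sorts := map (fun=> HomeSort) k.
pose fix vars (k : seq {classic I}) : hprod (two_sorted void I) (w k) :=
  match k return hprod (two_sorted void I) (w k) with
  | [::] => tt | i :: k => (i, vars k) end.
pose val (g : aut M0) k := hmap (home_env (N := calM M0) (g \o m)) (vars k).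
have valP (g h : aut M0) k' : val h k' = val g k' <->
    forall x : {classic M0}, x \in (map m k' : seq {classic M0}) -> h x = g x.
  elim: k' => [//|i k' IH]; rewrite /val /=; split=> [[him /IH hk] x|H].
    by rewrite in_cons => /orP[/eqP ->|/hk].
  congr pair; first by apply: H; rewrite mem_head.
  by apply/IH => x xk; apply: H; rewrite in_cons xk orbT.
exists (@Atom sig (two_sorted void I)
  (@FullRel _ (two_sorted (aut M0) M0) (w k) [set v | exists2 g, D g & v = val g k])
  (vars k)).
apply/seteqP; split=> h /= [g Dg /valP hg]; by exists g.
Qed.

End SigmaFlow.

(** * Equivariant maps from Sigma to an arbitrary flow *)

Section FlowMap.
Variables (L : language) (M0 : structure L) (N : sstructure (calM_sig M0)).
Variables (iota : elem_emb (calM M0) N) (I : Type) (m : I -> M0).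
Hypothesis hm : range m = [set: M0].
Variables (Y : topologicalType) (actY : Y -> aut M0 -> Y).
Hypothesis flowY : right_flow actY.
Variable y0 : Y.
Local Notation sig := (calM_sig M0).
Local Notation form := (@formula sig (two_sorted void I)).
Local Notation Sig := (Sigma iota m).
Implicit Types (q r : Sig) (phi psi : form) (g h : aut M0).

Definition orbit_image phi : set Y := actY y0 @` calM_tuples m phi.

(* The limit of [y0 . g] as the type of [g(m)] tends to [q]. *)
Definition limit_at q (y : Y) :=
  forall phi, Sigma_tp q phi -> closure (orbit_image phi) y.

Lemma limit_at_exists q : exists y, limit_at q y.
Proof.
have [cptY _ _ _ _] := flowY.
pose F := filter_from (Sigma_tp q) orbit_image.
have FF : Filter F.
  apply: filter_from_filter.
    exists (Defs.Implies Falsum Falsum).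
    by have [rho ->] := Sigma_surj q.
  move=> phi psi qphi qpsi; exists (And phi psi); first exact/Sigma_And.
  by rewrite /orbit_image calM_tuples_And => _ [g [gphi gpsi] <-]; split; exists g.
have PF : ProperFilter F.
  apply: filter_from_proper => phi /(calM_tuples_nonempty)[g gphi].
  by exists (actY y0 g); exists g.
have [y [_ yF]] := cptY F PF filterT.
by exists y => phi qphi B yB; apply: yF => //; exists phi.
Qed.

(** Choose [V] with closure inside the interior of [U], and by compactness [l] such that
    automorphisms fixing [l] move that closure into [U]. Let [phi] name the saturation of {g | y0 .
    g in V}. It lies in [q]: automorphisms satisfying its negation send [y0] outside [V], whereas
    [y] is a limit. *)
Lemma limit_at_nbhs q y (U : set Y) : limit_at q y -> nbhs y U ->
  exists2 phi, Sigma_tp q phi & orbit_image phi `<=` U.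
Proof.
have [cptY hausY act1 actM actC] := flowY; move=> qy yU.
have [V yV VU] := compact_regular hausY cptY (@filterT _ (nbhs y) _) (nbhs_interior yU).
have /compact_near_coveringP cptV : compact (closure V).
  by apply: subclosed_compact cptY _ => //; exact: closed_closure.
have /nbhs_autP[l lV] :
    nbhs (1%g : aut M0) [set u | closure V `<=` [set z | U (actY z u)]].
  apply: (cptV _ (nbhs (1%g : aut M0)) (fun u z => U (actY z u))) => z /VU.
  rewrite /interior -{1}[z]act1 => zU; exact: (actC (z, 1%g)).
pose D := [set g | V (actY y0 g)].
have [phi phiE] := calM_tuples_saturation hm D l.
have qphi : Sigma_tp q phi.
  apply: contrapT => /Sigma_Not /qy /(_ _ yV)[_ [[g gphi <-] Vg]].
  by apply: gphi; suff : calM_tuples m phi g by []; rewrite phiE; exists g.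
exists phi => // _ [h + <-]; rewrite phiE => -[g Dg hg].
(* The factor g^-1 h fixes [l] pointwise, as [h] and [g] agree there. *)
have -> : h = (g * (g^-1 * h))%g by rewrite mulgA mulgV mul1g.
rewrite actM; apply: lV; last exact: subset_closure.
move=> x /hg xE; rewrite /= xE.
by have /(congr1 (fun k : aut M0 => k x)) := mulVg g.
Qed.

Lemma limit_at_unique q y z : limit_at q y -> limit_at q z -> y = z.
Proof.
have [_ hausY _ _ _] := flowY; move=> qy qz; apply: hausY => A B yA zB.
have [phi qphi phiA] := limit_at_nbhs qy yA.
by have [x [/phiA xA xB]] := qz _ qphi _ zB; exists x.
Qed.

Lemma limit_at_act q y h : limit_at q y -> limit_at (Sigma_act q h) (actY y h).
Proof.
have [_ _ _ actM actC] := flowY; move=> qy phi.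
have [j jE] := exists_shift hm h; rewrite (Sigma_act_shift hm _ _ jE) => /qy yphi.
move=> B yB; have hB : nbhs y [set z | B (actY z h)].
  have [[/= U W] [yU hW] UWB] := actC (y, h) B yB.
  by apply: filterS yU => z zU; apply: (UWB (z, h)); split => //; exact: nbhs_singleton.
have [_ [[g + <-] Bg]] := yphi _ hB.
rewrite (calM_tuples_shift _ jE) /= => ghphi.
by exists (actY (actY y0 g) h); split=> //; exists (g * h)%g; rewrite // actM.
Qed.

Lemma Sigma_flow_map : exists f : Sig -> Y,
  continuous f /\ forall q g, f (Sigma_act q g) = actY (f q) g.
Proof.
have [cptY hausY _ _ _] := flowY.
have [f fP] := choice limit_at_exists; exists f; split; last first.
  by move=> q g; apply: limit_at_unique (fP _) _; exact: limit_at_act.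
move=> q U qU.
(* If [phi] forces the orbit image into [V], the limits at all types containing [phi] lie in the
   closure of [V], hence in [U]. *)
have [V qV VU] := compact_regular hausY cptY (@filterT _ (nbhs (f q)) _) qU.
have [phi qphi phiV] := limit_at_nbhs (fP q) qV.
apply/nbhs_SigmaP; exists phi => // r rphi; apply: VU.
exact: closure_subset phiV _ (fP r _ rphi).
Qed.

End FlowMap.

(** * The subspace topology on a subset *)

Section SubtypeTopology.
Variables (X : topologicalType) (K : set X).

Lemma nbhs_set_typeP (x : set_type K) (U : set (set_type K)) :
  nbhs x U <-> exists2 W, nbhs (set_val x) W & set_val @^-1` W `<=` U.
Proof.
split=> [[_ [[W oW <-] Wx WU]]|[W xW WU]].
  by exists W => //; exact: open_nbhs_nbhs.
by apply: filterS WU _; exact: initial_continuous.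
Qed.

Lemma hausdorff_set_type : hausdorff_space X -> hausdorff_space (set_type K).
Proof.
move=> hausX x y xy; apply: val_inj; apply: hausX => A B xA yB.
have [|//|z [zA zB]] := xy (set_val @^-1` A) (set_val @^-1` B).
- exact: initial_continuous.
- exact: initial_continuous.
- by exists (set_val z).
Qed.

Lemma compact_set_type : compact K -> compact [set: set_type K].
Proof.
move=> cptK F PF _.
pose v : set_type K -> X := set_val.
have [|z [Kz zF]] := cptK (v @ F) _.
  by apply: (@filterS _ F _ setT) filterT => x _; exact: (set_valP x).
exists (exist _ z (mem_set Kz)); split=> // A B FA /nbhs_set_typeP[W zW WB].
have [|_ [[x Ax <-] Wx]] := zF (v @` A) W _ zW.
  by apply: (@filterS _ F _ A) FA => x Ax; exists x.
by exists x; split=> //; exact: WB.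
Qed.

End SubtypeTopology.

(** * Syndetic return times and symmetry of orbit closures *)

Section ExpansionProperty.
Variables (L : language) (L0 : sublanguage L) (M : structure L).
Local Notation M0 := (reduct L0 M).
Hypothesis hREP : right_expansion_property L0 M.
Variables (N : sstructure (calM_sig M0)) (iota : elem_emb (calM M0) N).
Variables (I : Type) (m : I -> M0).
Hypothesis hm : range m = [set: M0].
Variable p : Sigma iota m.
Hypothesis hfix : forall g : aut M0, expansion_aut L0 M g -> Sigma_act p g = p.

Lemma reduct_aut (tau : aut M) :
  exists2 g : aut M0, expansion_aut L0 M g & forall x, g x = tau x.
Proof.
have tauP : is_automorphism (M := M0) tau.
  by case: (aut_is_automorphism tau) => b f r; split=> // s; [exact: f|exact: r].
by exists (Aut tauP) => //; exact: aut_is_automorphism tau.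
Qed.

Lemma fixed_type_syndetic phi : Sigma_tp p phi ->
  exists (J : finType) (c : J -> aut M0),
    forall g, exists i, Sigma_tp (Sigma_act p (g * c i)%g) phi.
Proof.
move=> pphi; have [l lP] := Sigma_act_support iota hm phi.
have [|B finB BP] := hREP (A := [set m i | i in [set` l]]).
  exact/finite_image/finite_seqP/ex_intro.
have /(finite_seqP (B : set {classic M}))[s sE] := finB.
(* A function [b] codes a possible copy in [B] of the coordinates in [l]. The translate for [b] is
   an automorphism realizing it, or the default 1 if there is none. *)
pose good (b : {ffun 'I_(size l) -> 'I_(size s)}) (h : aut M0) :=
  forall i, h (m (tnth (in_tuple l) i)) = tnth (in_tuple s) (b i).
exists {ffun 'I_(size l) -> 'I_(size s)}.
exists (fun b => if pselect (exists h, good b h) is left ex then sval (cid ex)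
                 else 1%g).
move=> g; have [tau tauB] := BP g; have [t tE tauE] := reduct_aut tau.
have /choice[b bP] : forall i : 'I_(size l), exists k : 'I_(size s),
    g (tnth (in_tuple s) k) = t (m (tnth (in_tuple l) i)).
  move=> i; have [|x + xE] := tauB (tau (m (tnth (in_tuple l) i))).
    exists (m (tnth (in_tuple l) i)) => //; exists (tnth (in_tuple l) i) => //.
    exact: mem_tnth.
  rewrite sE => /= xs; have /tnthP[k kE] : (x : {classic M}) \in in_tuple s by [].
  by exists k; rewrite -kE xE tauE.
exists (finfun b); case: pselect => [ex|[]]; last first.
  (* The pattern read off from [t] and [g] is realized by g^-1 t. *)
  exists (g^-1 * t)%g => i; rewrite ffunE /= -bP.
  by have /(congr1 (fun k : aut M0 => k (tnth (in_tuple s) (b i)))) := mulVg g.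
(* g h agrees with [t] on the support of [phi], and p . t = p. *)
case: (cid ex) => h hP; apply/(lP p (g * h)%g t); last by rewrite hfix.
move=> i il; have /tnthP[k ->] : i \in in_tuple l by [].
by rewrite /= hP ffunE bP.
Qed.

Local Notation orbit q := [set Sigma_act q g | g in [set: aut M0]].

(** If the orbit of [q] avoided [phi], then no q . c i would satisfy [phi]. For finitely many [i]
    this is an open condition on [q], so some p . g shares it, against syndeticity. *)
Lemma orbit_closure_sym q : closure (orbit p) q -> closure (orbit q) p.
Proof.
move=> pq W /nbhs_SigmaP[phi /fixed_type_syndetic[J [c cP]] phiW].
apply: contrapT => qW.
have /(filter_forall _)/pq[_ [[g _ <-] gP]] : forall i,
    nbhs q [set r | ~ Sigma_tp (Sigma_act r (c i)) phi].
  move=> i; have [j jE] := exists_shift hm (c i).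
  apply/nbhs_SigmaP; exists (Defs.Implies (shift j phi) Falsum).
    apply/Sigma_Not => /(Sigma_act_shift hm _ _ jE) qphi; apply: qW.
    by exists (Sigma_act q (c i)); split; [exists (c i)|exact: phiW].
  by move=> r /Sigma_Not rphi /(Sigma_act_shift hm _ _ jE).
by have [i] := cP g; rewrite Sigma_actM // => /gP.
Qed.

End ExpansionProperty.

(** * Minimality and universality of the orbit closure *)

Theorem theorem6p7 (L : language) (L0 : sublanguage L) (M : structure L)
    (hREP : right_expansion_property L0 M)
    (Mstar : sstructure (calM_sig (reduct L0 M)))
    (iota : elem_emb (calM (reduct L0 M)) Mstar)
    (kappa : Type) (hmonster : monster kappa Mstar)
    (I : Type) (m : I -> reduct L0 M) (hm : range m = [set: reduct L0 M])
    (sigma : Mstar AutSort)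
    (hsigma : aut_star (expansion_aut L0 M) sigma)
    (p : Sigma iota m) (hp : p = Sigma_of iota m sigma)
    (hfix : forall g : aut (reduct L0 M),
       expansion_aut L0 M g -> Sigma_act p g = p) :
  let K : set (Sigma iota m) :=
    closure [set Sigma_act p g | g in [set: aut (reduct L0 M)]] in
  exists actK : set_type K -> aut (reduct L0 M) -> set_type K,
    (forall (q : set_type K) (g : aut (reduct L0 M)),
       set_val (actK q g) = Sigma_act (set_val q) g) /\
    universal_minimal_right_flow actK.
Proof.
move=> K; have actC := @Sigma_act_continuous _ _ _ iota _ m hm.
have actCl (q : Sigma iota m) g W : nbhs (Sigma_act q g) W ->
    nbhs q [set r | W (Sigma_act r g)].
  move=> /(actC (q, g)) [[/= U V] [qU gV] UVW].
  by apply: filterS qU => r rU; apply: (UVW (r, g)); split => //; exact: nbhs_singleton.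
have Kact q g : K q -> K (Sigma_act q g).
  move=> Kq W /actCl/Kq[_ [[h _ <-] hW]].
  exists (Sigma_act (Sigma_act p h) g); split=> //.
  by exists (h * g)%g; rewrite // Sigma_actM.
have pK : K p.
  by apply: subset_closure; exists 1%g => //; exact: Sigma_act1.
pose actK (q : set_type K) g : set_type K :=
  exist _ (Sigma_act (set_val q) g) (mem_set (Kact _ g (set_valP q))).
have val_inj (x y : set_type K) : set_val x = set_val y -> x = y by exact: val_inj.
have flowK : right_flow actK.
  split.
  - apply/compact_set_type/(subclosed_compact _ (Sigma_compact hmonster)) => //.
    exact: closed_closure.
  - exact/hausdorff_set_type/Sigma_hausdorff.
  - by move=> q; apply: val_inj; exact: Sigma_act1.
  - by move=> q g h; apply: val_inj; exact: Sigma_actM.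
  - move=> [q g] U /nbhs_set_typeP[W qW WU].
    have [[/= V1 V2] [qV1 gV2] V12W] := actC (set_val q, g) W qW.
    exists (set_val @^-1` V1, V2).
      by split=> //=; exact: initial_continuous.
    by move=> [r h] /= [rV1 hV2]; apply: WU; exact: (V12W (set_val r, h)).
exists actK; split=> //; split.
  split=> //; first by exists (exist _ p (mem_set pK)).
  move=> F clF [q Fq] Fact; apply/seteqP; split=> // r _; apply: (clF r).
  (* The orbit of [q] stays in [F] and accumulates at [p]; then [F] contains the orbit of [p], which
     is dense in [K]. *)
  have Fp : F (exist _ p (mem_set pK)).
    apply: clF => U /nbhs_set_typeP[W pW WU].
    have [_ [[g _ <-] gW]] :=
      orbit_closure_sym hREP hm hfix (set_valP q) pW.
    by exists (actK q g); split; [exact: Fact|exact: WU].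
  move=> U /nbhs_set_typeP[W rW WU].
  have [_ [[g _ <-] gW]] := set_valP r _ rW.
  by exists (actK (exist _ p (mem_set pK)) g); split; [exact: Fact|exact: WU].
move=> Y actY [flowY [y0 _] minY].
have [f [fC fact]] := Sigma_flow_map iota hm flowY y0.
have [cptY hausY _ _ _] := flowY.
have fKC : continuous (f \o set_val : set_type K -> Y).
  move=> q; apply: continuous_comp; last exact: fC.
  exact: initial_continuous.
exists (f \o set_val); split=> //; first by move=> q g; exact: fact.
(* The image of [K] is compact, hence closed, and it is nonempty and invariant, so by minimality it
   is all of [Y]. *)
apply: minY.
- apply: compact_closed => //; apply: continuous_compact.
    exact: continuous_subspaceT.
  by case: flowK.
- by exists (f p); exists (exist _ p (mem_set pK)).
- by move=> _ g [q _ <-]; exists (actK q g) => //; exact: fact.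
Qed.
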